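(* Let $\mathbb{F}_q$ be a finite field, let $k,m,n\geqslant 1$ and $l\geqslant 0$ be integers where $n\geqslant l$, and let $\mathcal{V}=\{\mathbf{v}_1,\dots,\mathbf{v}_m\}\subseteq\mathbb{N}^n$. Assume that $l\leqslant 2$ and $\mathcal{V}$ satisfies property $V_l(k)$. Then the polynomials in $P(k,\mathcal{V})$ are linearly independent over $\mathbb{F}_q(x_1,\dots,x_n)$.
   Context: $\mathbb{N}=\{0,1,2,\dots\}$ and $[n]:=\{1,\dots,n\}$. $\mathbb{F}_q(x_1,\dots,x_n)$ is the field of rational functions in the formal variables $x_1,\dots,x_n$ over $\mathbb{F}_q$, and $x$ is a further formal variable. For $\mathbf{v}\in\mathbb{N}^n$, $\mathbf{v}(i)$ is its $i$-th coordinate and $|\mathbf{v}|:=\sum_{i=1}^n\mathbf{v}(i)$. For $\mathcal{V}=\{\mathbf{v}_1,\dots,\mathbf{v}_m\}\subseteq\mathbb{N}^n$ and nonempty $I\subseteq[m]$, let $\mu_{\mathcal{V}}(I)=(\min_{i\in I}\mathbf{v}_i(1),\dots,\min_{i\in I}\mathbf{v}_i(n))$. For integers $k,m,n\geqslant 1$ and $0\leqslant l\leqslant n$, $\mathcal{V}=\{\mathbf{v}_1,\dots,\mathbf{v}_m\}\subseteq\mathbb{N}^n$ satisfies property $V_l(k)$ if: (I) $|\mathbf{v}_i|\leqslant k-1$ for all $i\in[m]$; (II) for all nonempty $I\subseteq[m]$, $\sum_{i\in I}(k-|\mathbf{v}_i|)+|\mu_{\mathcal{V}}(I)|\leqslant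 k$; (III) $\mathbf{v}_i\in\{0,1\}^{n-l}\times\mathbb{N}^l$ for all $i\in[m]$. For $k>|\mathbf{v}|$, $P(k,\mathbf{v}):=\left\{\prod_{j\in[n]}(x-x_j)^{\mathbf{v}(j)}x^e : e=0,\dots,k-1-|\mathbf{v}|\right\}\subseteq \mathbb{F}_q(x_1,\dots,x_n)[x]$, and $P(k,\mathcal{V})=P(k,\mathbf{v}_1)\cup\dots\cup P(k,\mathbf{v}_m)$, understood as a multiset union (so $|P(k,\mathcal{V})|=\sum_i|P(k,\mathbf{v}_i)|$). *)

(* Defs.v *)
From HB Require Import structures.
From mathcomp Require Import all_boot all_order all_algebra.
From mathcomp.multinomials Require Import mpoly.

Set Implicit Arguments.
Unset Strict Implicit.
Unset Printing Implicit Defensive.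

Import GRing.Theory.
Local Open Scope ring_scope.

(* Vectors of N^n are exponent vectors 'X_{1..n}, with |v| = mdeg v;
   coordinates are numbered 0, ..., n-1. A family V of m vectors is a function
   on 'I_m. It need not be injective, but condition (II) of [propV] with
   I = {i, j} and V i = V j would give k <= |V i|, contradicting (I). *)

(* The minimum of an empty family is not defined, and minn has no neutral
   element, so the iterated minimum is started from the vector of some index
   in I, to which mu V I is insensitive (see [mu_le] and [mu_attained]); the
   value at I = set0 is irrelevant. *)
Definition mu (m n : nat) (V : 'I_m -> 'X_{1..n}) (I : {set 'I_m}) : 'X_{1..n} :=
  if [pick i in I] is Some i0
  then [multinom \big[minn/V i0 j]_(i in I) V i j | j < n]
  else 0%MM.

Lemma mu_le (m n : nat) (V : 'I_m -> 'X_{1..n}) (I : {set 'I_m}) (j : 'I_n)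
  (i : 'I_m) : i \in I -> (mu V I j <= V i j)%N.
Proof.
rewrite /mu; case: pickP => [i0 _ iI | /(_ i) -> //].
rewrite mnmE; have: i \in index_enum 'I_m by rewrite mem_index_enum.
elim: (index_enum _) => // a s IHs; rewrite inE big_cons.
case/predU1P=> [<- | /IHs le_s]; first by rewrite iI geq_minl.
by case: ifP => // _; apply: leq_trans (geq_minr _ _) le_s.
Qed.

Lemma mu_attained (m n : nat) (V : 'I_m -> 'X_{1..n}) (I : {set 'I_m})
  (j : 'I_n) : I != set0 -> exists2 i, i \in I & mu V I j = V i j.
Proof.
case/set0Pn=> i1 i1I; rewrite /mu.
case: pickP => [i0 i0I | /(_ i1)]; last by rewrite i1I.
rewrite mnmE; elim/big_ind: _ => [|a b [i iI ->] [i' i'I ->]|i iI].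
- by exists i0.
- by case: (leqP (V i j) (V i' j)) => _; [exists i | exists i'].
- by exists i.
Qed.

(* Property V_l(k); the subtraction k - |V i| is never truncated, by (I). *)
Definition propV (m n l k : nat) (V : 'I_m -> 'X_{1..n}) : Prop :=
  [/\ forall i : 'I_m, (mdeg (V i) <= k - 1)%N,
      forall I : {set 'I_m}, I != set0 ->
        (\sum_(i in I) (k - mdeg (V i)) + mdeg (mu V I) <= k)%N
    & forall (i : 'I_m) (j : 'I_n), (j < n - l)%N -> V i j \in [:: 0%N; 1%N]].

Definition ratfun (F : finFieldType) (n : nat) : fieldType :=
  {fraction {mpoly F[n]}}.

Definition ratvar (F : finFieldType) (n : nat) (j : 'I_n) : ratfun F n :=
  FracField.tofrac ('X_j : {mpoly F[n]}).

(* P(k, v) and P(k, V) are multisets, represented by sequences. *)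
Definition Pvec (F : finFieldType) (n k : nat) (v : 'X_{1..n}) :
    seq {poly ratfun F n} :=
  [seq (\prod_(j < n) ('X - (ratvar F j)%:P) ^+ v j) * 'X^e
     | e <- iota 0 (k - mdeg v)].

Definition Pfam (F : finFieldType) (m n k : nat) (V : 'I_m -> 'X_{1..n}) :
    seq {poly ratfun F n} :=
  flatten [seq Pvec F k (V i) | i <- enum 'I_m].

(* The library's [free] requires a finite-dimensional ambient space, which
   {poly K} is not. Repeated entries of s make it dependent. *)
Definition lin_indep (K : fieldType) (E : lmodType K) (s : seq E) : Prop :=
  forall c : 'I_(size s) -> K,
    \sum_(i < size s) c i *: s`_i = 0 -> forall i, c i = 0.

(* Main.v *)
(* Only l = 2 matters: all coordinates but two, p and q, are at most 1.  Induct
   on (k, |A|, total degree outside p) for the family of V over an index set A.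
   If a proper subfamily I with |I| > 1 is tight in (II), then independence
   follows from that of I and of the family where I is contracted to its
   minimum.  Otherwise, if some V_i vanishes at both p and some j other than p
   and q, while not all vanish at j, then specializing x_j := x_p keeps (II):
   the minimum grows by at most 1 on proper subfamilies, and not at all on A.
   Otherwise all V_i with V_i(p) = 0 agree outside q; so they are pairwise
   comparable, and by (II) at most one such i exists.  In a linear relation all
   other terms vanish at x_p, so its coefficient does too, and x - x_p can be
   divided out, which decreases k. *)
Require Import Defs.
From mathcomp Require Import all_boot all_order all_algebra.
From mathcomp.multinomials Require Import mpoly.
From mathcomp Require Import zify.

Set Implicit Arguments.
Unset Strict Implicit.
Unset Printing Implicit Defensive.

Import GRing.Theory.
Local Open Scope ring_scope.

(** * Linear independence as the rank of a coefficient matrix *)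

(** One multiplier [f i] per index carries the coefficients of all [g i * 'X^e] with [e < d i]. Thus
    equal products count separately, and common factors can be moved between [f i] and [g i]. *)
Definition poly_indep (K : fieldType) (T : finType) (A : {set T}) (d : T -> nat)
    (g : T -> {poly K}) : Prop :=
  forall f : T -> {poly K}, (forall i, i \in A -> (size (f i) <= d i)%N) ->
    \sum_(i in A) f i * g i = 0 -> forall i, i \in A -> f i = 0.

Definition coef_index (T : finType) (A : {set T}) (d : T -> nat) (D : nat) :
    {set T * 'I_D} :=
  [set x : T * 'I_D | (x.1 \in A) && (x.2 < d x.1)%N].

(** The entries stay in a ring [R], so that one matrix over a polynomial ring can be mapped into two
    different fields. *)
Definition coef_mx (R : nzRingType) (T : finType) (A : {set T}) (d : T -> nat)
    (D N : nat) (g : T -> {poly R}) : 'M[R]_(#|coef_index A d D|, N) :=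
  \matrix_(s < #|coef_index A d D|, j < N) (g (enum_val s).1 * 'X^((enum_val s).2))`_j.

Lemma map_coef_mx (R S : nzRingType) (phi : {rmorphism R -> S}) (T : finType)
  (A : {set T}) (d : T -> nat) (D N : nat) (g : T -> {poly R}) :
  map_mx phi (coef_mx A d D N g) = coef_mx A d D N (map_poly phi \o g).
Proof.
by apply/matrixP=> s j; rewrite !mxE /= -(map_polyXn phi) -rmorphM coef_map.
Qed.

(** A vanishing combination of rows is a vanishing sum of multipliers times [g i], read coefficient
    by coefficient. [D] and [N] merely make the matrix large enough. *)
Lemma poly_indepP (K : fieldType) (T : finType) (A : {set T}) (d : T -> nat)
  (D N : nat) (g : T -> {poly K}) :
  (forall i, i \in A -> (d i <= D)%N) ->
  (forall (i : T) (e : 'I_D), (size (g i * 'X^e)%R <= N)%N) ->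
  poly_indep A d g <-> row_free (coef_mx A d D N g).
Proof.
move=> dD gN; set M := coef_mx _ _ _ _ _.
set P := coef_index A d D in M *.
have rowE (v : 'rV_#|P|) : (v *m M = 0) <->
    \sum_s v 0 s *: (g (enum_val s).1 * 'X^((enum_val s).2)) = 0.
  split=> [vM|v0]; last first.
    apply/rowP=> j; rewrite !mxE; move/(congr1 (coefp j)): v0.
    rewrite /= coef_sum coef0 => v0; rewrite -[RHS]v0.
    by apply: eq_bigr => s _; rewrite mxE coefZ.
  apply/polyP=> j; rewrite coef0 coef_sum.
  have [jN|Nj] := ltnP j N; last first.
    rewrite big1 // => s _; rewrite coefZ nth_default ?mulr0 //.
    exact: leq_trans (gN _ _) Nj.
  move/rowP/(_ (Ordinal jN)): vM; rewrite !mxE => vM; rewrite -[RHS]vM.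
  by apply: eq_bigr => s _; rewrite mxE coefZ.
split=> [ind|free f sf f0 i iA].
  apply: inj_row_free => v /rowE v0; apply/rowP=> s; rewrite mxE.
  (* The entries of [v] in the rows with first index [i] become the coefficients of the multiplier
     at [i]. *)
  pose f i := \sum_(t | (@enum_val _ (mem P) t).1 == i) v 0 t *: 'X^((enum_val t).2).
  have := enum_valP s; rewrite inE => /andP[sA sd].
  have fs : f (enum_val s).1 = 0.
    apply: ind sA => [i iA|].
      apply: (big_ind (fun p : {poly K} => size p <= d i)%N).
      - by rewrite size_poly0.
      - by move=> p q ps qs; rewrite (leq_trans (size_polyD _ _)) // geq_max ps.
      - move=> t /eqP <-; rewrite (leq_trans (size_scale_leq _ _)) // size_polyXn.
        by have := enum_valP t; rewrite inE => /andP[].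
    rewrite -[RHS]v0 (partition_big (fun t => (@enum_val _ (mem P) t).1) (mem A)) /=.
      apply: eq_bigr => i _; rewrite /f mulr_suml; apply: eq_bigr => t /eqP <-.
      by rewrite -scalerAl mulrC.
    by move=> t _; have := enum_valP t; rewrite inE => /andP[].
  move/(congr1 (coefp (enum_val s).2)): fs; rewrite /= coef0 coef_sum.
  rewrite (bigD1 s) //= coefZ coefXn eqxx mulr1 big1 ?addr0 // => t /andP[/eqP ts].
  move=> ts'; rewrite coefZ coefXn [_ == _ :> nat]negbTE ?mulr0 //.
  apply: contraNneq ts' => /val_inj e; apply/eqP/enum_val_inj.
  by apply/eqP; rewrite -pair_eqE /= ts e !eqxx.
pose v : 'rV_#|P| := \row_(s < #|P|) (f (enum_val s).1)`_(enum_val s).2.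
have v0 : v = 0.
  apply/eqP; rewrite -(mulmx_free_eq0 v free); apply/eqP/rowE.
  rewrite (eq_bigr (fun s : 'I_#|P| => (f (enum_val s).1)`_(enum_val s).2 *:
      (g (enum_val s).1 * 'X^((enum_val s).2)))); last by move=> s _; rewrite mxE.
  rewrite -(@big_enum_val _ _ _ _ (mem P) (fun x => (f x.1)`_x.2 *: (g x.1 * 'X^(x.2)))).
  transitivity
    (\sum_(j in A) \sum_(e < D | (e < d j)%N) (f j)`_e *: (g j * 'X^e)).
    by rewrite pair_big_dep; apply: eq_bigl => x; rewrite inE.
  rewrite -[RHS]f0; apply: eq_bigr => j jA.
  rewrite {2}(_ : f j = \poly_(e < D) (f j)`_e).
    rewrite poly_def mulr_suml (big_mkcond (fun e : 'I_D => e < d j)%N).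
    apply: eq_bigr => e _; rewrite -scalerAl mulrC.
    case: ltnP => // de; rewrite nth_default ?scale0r //.
    exact: leq_trans (sf _ jA) de.
  apply/polyP=> e; rewrite coef_poly; case: ltnP => // De; rewrite nth_default //.
  exact: leq_trans (sf _ jA) (leq_trans (dD _ jA) De).
apply/polyP=> e; rewrite coef0; have [ed|de] := ltnP e (d i); last first.
  by rewrite nth_default // (leq_trans (sf _ iA) de).
have Pe : (i, Ordinal (leq_trans ed (dD _ iA))) \in P by rewrite inE /= iA.
move/rowP/(_ (enum_rank_in Pe (i, Ordinal (leq_trans ed (dD _ iA))))): v0.
by rewrite !mxE enum_rankK_in.
Qed.

(* A maximal minor that does not vanish at psi does not vanish at phi. *)
Lemma poly_indep_specialize (R : comNzRingType) (K L : fieldType)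
  (phi : {rmorphism R -> K}) (psi : {rmorphism R -> L}) (T : finType)
  (A : {set T}) (d : T -> nat) (g : T -> {poly R}) :
  injective phi -> poly_indep A d (map_poly psi \o g) ->
  poly_indep A d (map_poly phi \o g).
Proof.
move=> phi_inj; pose D := \max_(i in A) d i.
pose N := \max_(x : T * 'I_D) size (g x.1 * 'X^(x.2))%R.
have dD i : i \in A -> (d i <= D)%N by move=> iA; apply: leq_bigmax_cond.
have gN (S : fieldType) (theta : {rmorphism R -> S}) i (e : 'I_D) :
    (size (map_poly theta (g i) * 'X^e)%R <= N)%N.
  rewrite -(map_polyXn theta) -rmorphM (leq_trans (size_poly _ _)) //.
  exact: (leq_bigmax (i, e)).
move/(poly_indepP dD (gN _ psi)) => free_psi; apply/(poly_indepP dD (gN _ phi)).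
rewrite -map_coef_mx in free_psi; rewrite -map_coef_mx.
set M := coef_mx _ _ _ _ _ in free_psi *.
(* Transposing lets [fullrankfun] select columns of [M] that form a maximal minor invertible under
   [psi]. *)
have full : row_full (map_mx psi M)^T by rewrite /row_full mxrank_tr.
have := fullrowsub_unit full; set h := fullrankfun full.
rewrite map_trmx -map_mxsub unitmxE unitfE det_map_mx => det_nz.
rewrite /row_free -mxrank_tr; apply/eqP; rewrite map_trmx.
(* The minor is formed over [R]: it is nonzero there because its image under [psi] is, and the
   injective [phi] keeps it nonzero. *)
have : rowsub h (map_mx phi M^T) \in unitmx.
  rewrite -map_mxsub unitmxE unitfE det_map_mx -(rmorph0 phi) (inj_eq phi_inj).
  by apply: contraNneq det_nz => ->; rewrite rmorph0.
rewrite -row_full_unit => /eqP full_phi; apply/eqP.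
by rewrite eqn_leq rank_leq_col -{1}full_phi mxrankS ?rowsub_sub.
Qed.

(** * Products of linear factors, admissible families and contraction *)

Definition vprod (R : comNzRingType) (n : nat) (a : 'I_n -> R) (v : 'X_{1..n}) :
    {poly R} :=
  \prod_(j < n) ('X - (a j)%:P) ^+ v j.

Definition Vindep (K : fieldType) (n : nat) (a : 'I_n -> K) (k : nat)
    (T : finType) (A : {set T}) (V : T -> 'X_{1..n}) : Prop :=
  poly_indep A (fun i => k - mdeg (V i))%N (fun i => vprod a (V i)).

(* Condition (II) is stated through all lower bounds [w] of the family rather
   than through its minimum. *)
Definition admissible (n : nat) (p q : 'I_n) (k : nat) (T : finType)
    (A : {set T}) (V : T -> 'X_{1..n}) : Prop :=
  [/\ forall i, i \in A -> (mdeg (V i) < k)%N,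
      forall (I : {set T}) (w : 'X_{1..n}), I \subset A -> I != set0 ->
        (forall i, i \in I -> (w <= V i)%MM) ->
        (\sum_(i in I) (k - mdeg (V i)) + mdeg w <= k)%N
    & forall i j, i \in A -> j != p -> j != q -> (V i j <= 1)%N].

Lemma vprodD (R : comNzRingType) (n : nat) (a : 'I_n -> R) (u v : 'X_{1..n}) :
  vprod a (u + v)%MM = vprod a u * vprod a v.
Proof.
by rewrite /vprod -big_split; apply: eq_bigr => j _; rewrite mnmDE exprD.
Qed.

Lemma vprodU (R : comNzRingType) (n : nat) (a : 'I_n -> R) (j : 'I_n) (c : nat) :
  vprod a (U_(j) *+ c)%MM = ('X - (a j)%:P) ^+ c.
Proof.
rewrite /vprod (bigD1 j) //= big1 => [|l lj].
  by rewrite mulmnE mnm1E eqxx mul1n mulr1.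
by rewrite mulmnE mnm1E eq_sym (negbTE lj) mul0n expr0.
Qed.

Lemma eq_vprod (R : comNzRingType) (n : nat) (a b : 'I_n -> R) (v : 'X_{1..n}) :
  (forall j, v j != 0%N -> a j = b j) -> vprod a v = vprod b v.
Proof.
move=> ab; apply: eq_bigr => j _.
by have [->|/ab->] := eqVneq (v j) 0%N; rewrite ?expr0.
Qed.

Lemma map_vprod (R S : comNzRingType) (phi : {rmorphism R -> S}) (n : nat)
  (a : 'I_n -> R) (v : 'X_{1..n}) :
  map_poly phi (vprod a v) = vprod (phi \o a) v.
Proof.
rewrite rmorph_prod; apply: eq_bigr => j _.
by rewrite rmorphXn rmorphB /= map_polyX map_polyC.
Qed.

Lemma size_vprod (K : fieldType) (n : nat) (a : 'I_n -> K) (v : 'X_{1..n}) :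
  size (vprod a v) = (mdeg v).+1.
Proof.
rewrite size_prod => [|j _]; last by rewrite expf_neq0 ?polyXsubC_eq0.
rewrite (eq_bigr (fun j => v j + 1)%N) => [|j _]; last first.
  by rewrite size_exp_XsubC addn1.
by rewrite big_split /= sum_nat_const muln1 -mdegE -addSn addnK.
Qed.

Lemma root_vprod (K : fieldType) (n : nat) (a : 'I_n -> K) (v : 'X_{1..n})
  (p : 'I_n) : injective a -> root (vprod a v) (a p) = (v p != 0%N).
Proof.
move=> a_inj; apply/idP/idP; last first.
  rewrite -lt0n => vp; rewrite /vprod (bigD1 p) //= rootM.
  by rewrite -(prednK vp) root_exp_XsubC eqxx.
apply: contraL => /eqP vp; rewrite /root /vprod horner_prod prodf_seq_neq0.
apply/allP=> j _; rewrite /= horner_exp hornerXsubC.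
have [->|jp] := eqVneq j p; first by rewrite vp expr0 oner_eq0.
by rewrite expf_neq0 // subr_eq0 (inj_eq a_inj) eq_sym.
Qed.

(* The product of the sum over [I] with the common factor of [w] plays the
   role of a single polynomial for [w]. *)
Lemma Vindep_contract (K : fieldType) (n : nat) (a : 'I_n -> K) (k : nat)
  (T : finType) (A I : {set T}) (V : T -> 'X_{1..n}) (w : 'X_{1..n}) (i0 : T) :
  I \subset A -> i0 \in I -> (forall i, i \in A -> (mdeg (V i) <= k)%N) ->
  (forall i, i \in I -> (w <= V i)%MM) -> Vindep a k I V ->
  Vindep a k (i0 |: (A :\: I)) (fun i => if i == i0 then w else V i) ->
  Vindep a k A V.
Proof.
move=> IA i0I Vk wV indI indw f sf f0.
pose h := \sum_(i in I) f i * vprod a (V i - w)%MM.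
have hw : h * vprod a w = \sum_(i in I) f i * vprod a (V i).
  rewrite mulr_suml; apply: eq_bigr => i iI.
  by rewrite -mulrA -vprodD submK // wV.
have sh : (size h <= k - mdeg w)%N.
  apply: (big_ind (fun p : {poly K} => size p <= k - mdeg w)%N).
  - by rewrite size_poly0.
  - by move=> p q ps qs; rewrite (leq_trans (size_polyD _ _)) // geq_max ps.
  (* [f i] has size at most [k - mdeg (V i)] and its cofactor has degree [mdeg (V i) - mdeg w], so
     their product has size at most [k - mdeg w]. *)
  - move=> i iI; rewrite (leq_trans (size_polyMleq _ _)) // size_vprod.
    have iA := subsetP IA i iI; have := sf i iA; have := Vk i iA.
    by have := mdegD (V i - w) w; rewrite submK ?wV //; lia.
have i0D : i0 \notin A :\: I by rewrite inE i0I.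
have neq_i0 i : i \in A :\: I -> (i == i0) = false.
  by apply: contraTF => /eqP->.
pose f' i := if i == i0 then h else f i.
have f'0 i : i \in i0 |: (A :\: I) -> f' i = 0.
  apply: indw => [j|].
    rewrite /f' inE in_set1; case: eqP => //= _; rewrite inE => /andP[_].
    exact: sf.
  rewrite big_setU1 //= /f' eqxx hw -[RHS]f0 [RHS](big_setID I) /=.
  rewrite (setIidPr IA); congr (_ + _); apply: eq_bigr => j /neq_i0 ji.
  by rewrite ji.
have h0 : h = 0 by have := f'0 i0; rewrite /f' eqxx => -> //; rewrite setU11.
move=> i iA; have [iI|iI] := boolP (i \in I).
  apply: indI iI => [j jI|]; first exact/sf/(subsetP IA).
  by rewrite -hw h0 mul0r.
have iD : i \in A :\: I by rewrite inE iI.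
by have := f'0 i (setU1r _ iD); rewrite /f' neq_i0.
Qed.

(** Tightness makes [k - mdeg w] equal to the sum over [I], so (II) for a set through [i0] is the
    old condition with [I] put in place of [i0]. *)
Lemma admissible_contract (n : nat) (p q : 'I_n) (k : nat)
  (T : finType) (A I : {set T}) (V : T -> 'X_{1..n}) (w : 'X_{1..n}) (i0 : T) :
  admissible p q k A V -> I \subset A -> i0 \in I ->
  (forall i, i \in I -> (w <= V i)%MM) ->
  (\sum_(i in I) (k - mdeg (V i)) + mdeg w = k)%N ->
  admissible p q k (i0 |: (A :\: I)) (fun i => if i == i0 then w else V i).
Proof.
move=> [Vk VII VIII] IA i0I wV tight; have i0A := subsetP IA _ i0I.
have neq_i0 i : i \in A :\: I -> (i == i0) = false.
  by apply: contraTF => /eqP->; rewrite inE i0I.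
split=> [i|J u JA J0 uV|i j].
- rewrite inE in_set1; case: eqP => [_ _|_ /=]; last by rewrite inE => /andP[_ /Vk].
  by move: tight; rewrite (bigD1 i0) //=; have := Vk _ i0A; lia.
- have JD j : j \in J -> j != i0 -> j \in A :\: I.
    by move=> /(subsetP JA); rewrite inE in_set1 => /orP[/eqP->|//]; rewrite eqxx.
  have [i0J|i0J] := boolP (i0 \in J); last first.
    rewrite (eq_bigr (fun i => k - mdeg (V i))%N) => [|i iJ]; last first.
      by case: eqP iJ i0J => // -> ->.
    apply: VII => // [|i iJ].
      apply/subsetP=> i iJ; have : i != i0 by apply: contraNneq i0J => <-.
      by move/(JD _ iJ); rewrite inE => /andP[].
    by have := uV i iJ; case: eqP iJ i0J => // -> ->.
  have disj : [disjoint I & J :\ i0].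
    apply/pred0P=> i; rewrite /= !inE; apply/negP=> /and3P[iI ii0 iJ].
    by have := JD i iJ ii0; rewrite inE iI.
  have /VII : I :|: (J :\ i0) \subset A.
    rewrite subUset IA; apply/subsetP=> i; rewrite inE in_set1 => /andP[ii0 iJ].
    by have := JD i iJ ii0; rewrite inE => /andP[].
  move=> /(_ u) bound; have {bound} : (\sum_(i in I :|: (J :\ i0))
      (k - mdeg (V i)) + mdeg u <= k)%N.
    apply: bound => [|i].
      by apply/set0Pn; exists i0; rewrite inE i0I.
    rewrite inE => /orP[iI|].
      apply: lepm_trans (wV _ iI); have := uV i0 i0J; by rewrite eqxx.
    rewrite inE in_set1 => /andP[/negbTE ii0 iJ]; have := uV i iJ; by rewrite ii0.
  have -> : (\sum_(i in I :|: (J :\ i0)) (k - mdeg (V i)) =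
      \sum_(i in I) (k - mdeg (V i)) + \sum_(i in J :\ i0) (k - mdeg (V i)))%N.
    by rewrite -bigU //; apply: eq_bigl => i; rewrite !inE.
  rewrite [X in _ -> (X + _ <= _)%N](big_setD1 i0) //= eqxx.
  have -> : (\sum_(i in J :\ i0) (k - mdeg (V i)) =
      \sum_(i in J :\ i0) (k - mdeg (if i == i0 then w else V i)))%N.
    by apply: eq_bigr => i; rewrite inE in_set1 => /andP[/negbTE->].
  by move: tight; lia.
- rewrite inE in_set1; case: eqP => [_ _ jp jq|_ /= iD].
    by apply: leq_trans (VIII _ _ i0A jp jq); exact: mnm_lepP (wV _ i0I) j.
  by apply: VIII; move: iD; rewrite inE => /andP[].
Qed.

(** * Specialization of one variable to another *)

(** Built from multiples of unit vectors so that [vprodD] and [mdegD] compute it. For [j = p] it is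
    the identity. *)
Definition merge (n : nat) (p j : 'I_n) (v : 'X_{1..n}) : 'X_{1..n} :=
  (v - U_(j) *+ v j + U_(p) *+ v j)%MM.

Lemma mulm1_le (n : nat) (j : 'I_n) (v : 'X_{1..n}) : (U_(j) *+ v j <= v)%MM.
Proof.
apply/mnm_lepP=> l; rewrite mulmnE mnm1E.
by case: eqP => [->|_]; rewrite ?mul1n ?mul0n.
Qed.

Lemma mdeg_merge (n : nat) (p j : 'I_n) (v : 'X_{1..n}) :
  mdeg (merge p j v) = mdeg v.
Proof.
have := mdegD (v - U_(j) *+ v j) (U_(j) *+ v j).
by rewrite submK ?mulm1_le // /merge mdegD !mdegMn !mdeg1 => ->.
Qed.

Lemma mergeE (n : nat) (p j l : 'I_n) (v : 'X_{1..n}) : j != p ->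
  merge p j v l =
    (if l == j then 0 else if l == p then v p + v j else v l)%N.
Proof.
move=> jp; rewrite mnmDE mnmBE !mulmnE !mnm1E [j == l]eq_sym [p == l]eq_sym.
have [->|lj] := eqVneq l j; first by rewrite (negbTE jp); lia.
by have [->|lp] := eqVneq l p; lia.
Qed.

(** Once the factor at [j] is split off, no exponent at [j] remains, so changing the point at [j]
    has no further effect. *)
Lemma vprod_merge (R : comNzRingType) (n : nat) (a : 'I_n -> R) (p j : 'I_n)
  (v : 'X_{1..n}) :
  vprod (fun l => a (if l == j then p else l)) v = vprod a (merge p j v).
Proof.
rewrite /merge vprodD vprodU -{1}(submK (mulm1_le j v)).
rewrite vprodD vprodU eqxx; congr (_ * _); apply: eq_vprod => l.
rewrite mnmBE mulmnE mnm1E [j == l]eq_sym.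
by have [->|//] := eqVneq l j; rewrite mul1n subnn.
Qed.

(* Merging coordinates of the exponents is specializing [x_j := x_p]. *)
Lemma Vindep_merge (F : finFieldType) (n k : nat) (T : finType) (A : {set T})
  (V : T -> 'X_{1..n}) (p j : 'I_n) :
  Vindep (@ratvar F n) k A (merge p j \o V) -> Vindep (@ratvar F n) k A V.
Proof.
move=> ind.
(* The substitution is defined on polynomials in the variables, not on fractions; [vprod] over
   [{mpoly F[n]}] is the common source of both families. *)
pose psi := mmap (@FracField.tofrac {mpoly F[n]} \o @mpolyC n F)
  (fun l => @ratvar F n (if l == j then p else l)).
have psiE i : map_poly psi (vprod (fun l => 'X_l) (V i)) =
    vprod (@ratvar F n) (merge p j (V i)).
  rewrite map_vprod -vprod_merge; apply: eq_vprod => l _.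
  by rewrite /= /psi mmapX mmap1U.
have phiE i : map_poly (@FracField.tofrac {mpoly F[n]})
    (vprod (fun l => 'X_l) (V i)) = vprod (@ratvar F n) (V i).
  by rewrite map_vprod; apply: eq_vprod.
have := @poly_indep_specialize _ _ _ (@FracField.tofrac {mpoly F[n]}) psi T A
  (fun i => k - mdeg (V i))%N (fun i => vprod (fun l => 'X_l) (V i)).
move=> spec f sf f0; apply: spec => //.
- by move=> x y /eqP; rewrite tofrac_eq => /eqP.
- move=> g sg g0; apply: ind => [i iA|].
    by rewrite /= mdeg_merge; apply: sg.
  by rewrite -[RHS]g0; apply: eq_bigr => i _; rewrite /= psiE.
- by rewrite -[RHS]f0; apply: eq_bigr => i _; rewrite /= phiE.
Qed.

(** * Division by [x - x_p], and admissibility after division or merging *)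

Lemma subU_eq0 (n : nat) (v : 'X_{1..n}) (p : 'I_n) :
  v p = 0%N -> (v - U_(p))%MM = v.
Proof.
move=> vp; apply/mnmP=> l; rewrite mnmBE mnm1E.
by case: eqP => [<-|_]; rewrite ?vp ?subn0.
Qed.

Lemma mdeg_subU (n : nat) (v : 'X_{1..n}) (p : 'I_n) :
  mdeg (v - U_(p))%MM = (mdeg v - (v p != 0))%N.
Proof.
have [vp|vp] := eqVneq (v p) 0%N; first by rewrite subU_eq0 // subn0.
by have := mdegD (v - U_(p)) U_(p); rewrite submK ?lep1mP // mdeg1; lia.
Qed.

(** Truncated subtraction leaves a vector with exponent 0 at [p] unchanged, so only its multiplier
    is divided. Such an index leaves the family if its degree is [k.-1], when no power remains for
    it; all others stay. *)
Lemma Vindep_shift (K : fieldType) (n : nat) (a : 'I_n -> K) (p : 'I_n)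
  (k : nat) (T : finType) (A : {set T}) (V : T -> 'X_{1..n}) :
  injective a -> (forall i, i \in A -> (mdeg (V i) < k)%N) ->
  (forall i j, i \in A -> j \in A -> V i p = 0%N -> V j p = 0%N -> i = j) ->
  Vindep a k.-1 [set i in A | (mdeg (V i - U_(p))%MM < k.-1)%N]
    (fun i => V i - U_(p))%MM ->
  Vindep a k A V.
Proof.
move=> a_inj Vk uniq_p ind f sf f0; pose L := 'X - (a p)%:P.
have root_f i : i \in A -> V i p = 0%N -> root (f i) (a p).
  move=> iA Vip; move/(congr1 (horner_eval (a p))): f0.
  rewrite /horner_eval horner0 horner_sum (bigD1 i) //= big1 => [|j /andP[jA ji]].
    move/eqP; rewrite addr0 hornerM mulf_eq0 => /orP[//|].
    by rewrite -/(root _ _) root_vprod // Vip.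
  apply/eqP; rewrite hornerM mulf_eq0 -![_.[_] == 0]/(root _ _) root_vprod //.
  by apply/orP; right; apply: contra ji => /eqP Vjp; apply/eqP/uniq_p.
(* The factor [L] is taken from the multiplier where [V i p] is zero, and from the product
   elsewhere. *)
pose h i := if V i p == 0%N then f i %/ L else f i.
have Usub i : V i p != 0%N -> (U_(p) <= V i)%MM by rewrite lep1mP.
have fh i : i \in A -> f i = h i * (if V i p == 0%N then L else 1).
  move=> iA; rewrite /h; case: eqP => [Vip|_]; last by rewrite mulr1.
  by rewrite divpK // dvdp_XsubCl root_f.
have degV i := mdeg_subU (V i) p.
have vprodV i : vprod a (V i) =
    vprod a (V i - U_(p))%MM * (if V i p == 0%N then 1 else L).
  have [Vip|Vip] := eqVneq (V i p) 0%N.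
    by rewrite mulr1 subU_eq0.
  by rewrite -[L]expr1 -vprodU -vprodD mulm1n submK ?Usub.
have sh i : i \in A -> (size (h i) <= k.-1 - mdeg (V i - U_(p)))%N.
  move=> iA; rewrite degV /h; have := Vk i iA.
  have [Vip|Vip] /= := eqVneq (V i p) 0%N; last first.
    have : (V i p <= mdeg (V i))%N by rewrite mdegE (bigD1 p) //= leq_addr.
    by move=> *; apply: leq_trans (sf i iA) _; lia.
  rewrite size_divp ?polyXsubC_eq0 // size_XsubC => ?.
  by apply: leq_trans (leq_sub2r _ (sf i iA)) _; lia.
have h0 i : i \in A -> h i = 0.
  move=> iA; set A' := finset _ in ind.
  (* Outside [A'] the size bound on [h i] is 0. *)
  have [iA'|iA'] := boolP (i \in A'); last first.
    apply/eqP; rewrite -size_poly_leq0 (leq_trans (sh i iA)) //.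
    by move: iA'; rewrite inE iA /=; lia.
  apply: ind iA' => [j|]; first by rewrite inE => /andP[/sh].
  apply: (mulIf (negbT (polyXsubC_eq0 (a p)))); rewrite mul0r -[RHS]f0 mulr_suml.
  rewrite big_mkcond [RHS]big_mkcond; apply: eq_bigr => j _; rewrite inE.
  have [jA|//] := boolP (j \in A); rewrite /= vprodV fh //.
  case: ltnP => [_|kj].
    by case: eqP => _; rewrite ?mulr1 -!mulrA // [L * _]mulrC.
  have -> : h j = 0; last by rewrite !mul0r.
  by apply/eqP; rewrite -size_poly_leq0 (leq_trans (sh j jA)) //; lia.
by move=> i iA; rewrite fh // h0 // mul0r.
Qed.

(** Terms of (II) with positive exponent at [p] do not change. The bound may drop to [k.-1] for one
    of two reasons: the index with exponent 0 at [p] is in [I] and its term drops by one, or there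
    is none in [I] and [w + U_(p)] bounds the old vectors from below. *)
Lemma admissible_shift (n : nat) (p q : 'I_n) (k : nat) (T : finType)
  (A : {set T}) (V : T -> 'X_{1..n}) :
  admissible p q k A V ->
  (forall i j, i \in A -> j \in A -> V i p = 0%N -> V j p = 0%N -> i = j) ->
  admissible p q k.-1 [set i in A | (mdeg (V i - U_(p))%MM < k.-1)%N]
    (fun i => V i - U_(p))%MM.
Proof.
move=> [Vk VII VIII] uniq_p; set A' := finset _.
have A'A : A' \subset A by apply/subsetP=> i; rewrite inE => /andP[].
have Usub i : V i p != 0%N -> (U_(p) <= V i)%MM by rewrite lep1mP.
have degV i := mdeg_subU (V i) p.
have degp i : (V i p <= mdeg (V i))%N by rewrite mdegE (bigD1 p) //= leq_addr.
split=> [i|I w IA' I0 wV|i j iA' jp jq].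
- by rewrite inE => /andP[].
- have IA := subset_trans IA' A'A.
  have term i : i \in I -> V i p != 0%N ->
      (k.-1 - mdeg (V i - U_(p)) = k - mdeg (V i))%N.
    move=> iI Vip; rewrite degV Vip; have := Vk i (subsetP IA i iI).
    by have := degp i; lia.
  have [/existsP[i1 /andP[i1I /eqP Vi1p]]|noI] :=
      boolP [exists i in I, V i p == 0%N].
    have i1k : (mdeg (V i1) < k.-1)%N.
      by have := subsetP IA' _ i1I; rewrite inE degV Vi1p subn0 => /andP[].
    rewrite (bigD1 i1 i1I) /= degV Vi1p /= subn0.
    rewrite (eq_bigr (fun i => k - mdeg (V i))%N) => [|i /andP[iI ii1]]; last first.
      apply: term => //; apply: contra ii1 => /eqP Vip; apply/eqP/uniq_p => //;
      exact: subsetP IA _ _.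
    have := VII I w IA I0; rewrite (bigD1 i1 i1I) /= => bound.
    have := bound (fun i iI => lepm_trans (wV i iI) (lem_subr _ _)).
    by lia.
  have VI i : i \in I -> V i p != 0%N.
    by move=> iI; apply: contraNN noI => Vip; apply/existsP; exists i; rewrite iI.
  rewrite (eq_bigr (fun i => k - mdeg (V i))%N) => [|i iI]; last exact/term/VI.
  have := VII I (w + U_(p))%MM IA I0; rewrite mdegD mdeg1 => bound.
  have {bound} : (\sum_(i in I) (k - mdeg (V i)) + (mdeg w + 1) <= k)%N.
    apply: bound => i iI; apply/mnm_lepP=> l; rewrite mnmDE.
    have /mnm_lepP/(_ l) := wV i iI; rewrite mnmBE.
    by have /mnm_lepP/(_ l) := Usub _ (VI i iI); lia.
  by lia.
- rewrite mnmBE (leq_trans (leq_subr _ _)) // VIII //.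
  exact: subsetP A'A _ _.
Qed.

(** Exponents at [j] are at most 1, so [w - U_(p)] bounds the old vectors from below, and strictness
    in (II) absorbs the lost unit. Singletons are safe because merging keeps degrees. On all of [A],
    the vector of [i0] forces [w p = 0], so nothing is lost. *)
Lemma admissible_merge (n : nat) (p q j : 'I_n) (k : nat) (T : finType)
  (A : {set T}) (V : T -> 'X_{1..n}) (i0 : T) :
  admissible p q k A V ->
  (forall (I : {set T}) (w : 'X_{1..n}), I \proper A -> (1 < #|I|)%N ->
     (forall i, i \in I -> (w <= V i)%MM) ->
     (\sum_(i in I) (k - mdeg (V i)) + mdeg w < k)%N) ->
  j != p -> j != q -> i0 \in A -> V i0 p = 0%N -> V i0 j = 0%N ->
  admissible p q k A (merge p j \o V).
Proof.
move=> [Vk VII VIII] slack jp jq i0A V0p V0j.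
split=> [i iA|I w IA I0 wV|i l iA lp lq]; first by rewrite /= mdeg_merge Vk.
  rewrite (eq_bigr (fun i => k - mdeg (V i))%N) => [|i _]; last first.
    by rewrite /= mdeg_merge.
  have wVi i : i \in I -> (w - U_(p) <= V i)%MM.
    move=> iI; apply/mnm_lepP=> l; rewrite mnmBE mnm1E.
    have /mnm_lepP/(_ l) := wV i iI; rewrite /= mergeE //.
    have [->|lj] := eqVneq l j; first by lia.
    have [->|lp] := eqVneq l p; last by lia.
    by have := VIII i j (subsetP IA i iI) jp jq; lia.
  have := mdeg_subU w p; have [wp|wp] := eqVneq (w p) 0%N; rewrite /= => degw.
    by have := VII I _ IA I0 wVi; lia.
  have [I1|I1] := leqP #|I| 1.
    have /cards1P[i Ii] : #|I| == 1%N by rewrite eqn_leq I1 card_gt0.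
    have iI : i \in I by rewrite Ii set11.
    rewrite Ii big_set1; have : (mdeg w <= mdeg (V i))%N.
      rewrite -(mdeg_merge p j (V i)) !mdegE; apply: leq_sum => l _.
      exact: mnm_lepP (wV i iI) l.
    by have := Vk i (subsetP IA i iI); lia.
  have [IeqA|IneA] := eqVneq I A.
    have i0I : i0 \in I by rewrite IeqA.
    have /mnm_lepP/(_ p) := wV i0 i0I.
    by rewrite /= mergeE // eqxx eq_sym (negbTE jp) V0p V0j; lia.
  have := slack I _ _ I1 wVi; rewrite properEneq IneA IA => /(_ isT).
  have : (w p <= mdeg w)%N by rewrite mdegE (bigD1 p) //= leq_addr.
  by lia.
rewrite /= mergeE //; case: ifP => // _; rewrite (negbTE lp).
exact: VIII.
Qed.

(** * The induction over admissible families *)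

Lemma ratvar_inj (F : finFieldType) (n : nat) : injective (@ratvar F n).
Proof.
move=> i j /eqP; rewrite /ratvar tofrac_eq => /eqP/(congr1 (mcoeff U_(i))).
rewrite !mcoeffX !eq_mnm1 eqxx; have [->//|ij] := eqVneq j i.
by move/eqP; rewrite oner_eq0.
Qed.

Lemma Vindep_ratvar (F : finFieldType) (n : nat) (p q : 'I_n) (k : nat)
  (T : finType) (A : {set T}) (V : T -> 'X_{1..n}) :
  admissible p q k A V -> Vindep (@ratvar F n) k A V.
Proof.
elim/ltn_ind: k => k IHk in A V *.
have [c] := ubnP #|A|; elim: c => // c IHc in A V *; rewrite ltnS => Ac.
(* Merging [j] into [p] lowers this sum by the total of the exponents at [j]. *)
have [s] := ubnP (\sum_(i in A) (mdeg (V i) - V i p)).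
elim: s => // s IHs in V *; rewrite ltnS => Vs adm.
have [Vk VII VIII] := adm.
move=> f sf f0 i iA; have [//|fi] := eqVneq (f i) 0; exfalso.
(* With a nonzero multiplier assumed, any reduction to a smaller independent family is
   contradictory; this excludes the reducible cases one by one. *)
have dependent : ~ Vindep (@ratvar F n) k A V.
  by move/(_ f sf f0 i iA)/eqP; rewrite (negbTE fi).
have slack (I : {set T}) (w : 'X_{1..n}) : I \proper A -> (1 < #|I|)%N ->
    (forall i, i \in I -> (w <= V i)%MM) ->
    (\sum_(i in I) (k - mdeg (V i)) + mdeg w < k)%N.
  move=> IpA I1 wV; have IA := proper_sub IpA; have ltIA := proper_card IpA.
  have /set0Pn[i0 i0I] : I != set0 by rewrite -card_gt0 ltnW.
  rewrite ltn_neqAle VII // ?andbT; last by apply/set0Pn; exists i0.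
  apply/eqP=> tight; apply: dependent.
  apply: (Vindep_contract IA i0I _ wV) => [l lA||]; first exact/ltnW/Vk.
    apply: IHc; first exact: leq_trans ltIA Ac.
    split=> [l lI|J w' JI|l j lI]; first exact/Vk/(subsetP IA).
      by apply: VII; apply: subset_trans IA.
    by apply: VIII; apply: (subsetP IA).
  apply: IHc; last exact: admissible_contract.
  (* The contracted family has [#|A| - #|I| + 1] members, fewer than [A] because [#|I|] exceeds
     1. *)
  rewrite cardsU1 inE i0I /= cardsD (setIidPr IA).
  by lia.
have same j l l' : j != p -> j != q -> l \in A -> l' \in A ->
    V l p = 0%N -> V l j = 0%N -> V l' j = 0%N.
  move=> jp jq lA l'A Vlp Vlj; apply/eqP/negPn/negP=> Vl'j; apply: dependent.
  apply: (@Vindep_merge _ _ _ _ _ _ p j); apply: IHs; last first.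
    exact: admissible_merge slack jp jq lA Vlp Vlj.
  apply: leq_trans Vs; rewrite [X in (_ < X)%N](bigD1 l') //= (bigD1 l') //=.
  rewrite -addSn leq_add //; last first.
    apply: leq_sum => x _; rewrite mdeg_merge mergeE // eqxx eq_sym (negbTE jp).
    exact/leq_sub2l/leq_addr.
  rewrite mdeg_merge mergeE // eqxx [p == j]eq_sym (negbTE jp).
  have : (V l' p + V l' j <= mdeg (V l'))%N.
    by rewrite mdegE (bigD1 p) //= (bigD1 j) //= leq_add2l leq_addr.
  by move: Vl'j; lia.
have uniq_p l l' : l \in A -> l' \in A -> V l p = 0%N -> V l' p = 0%N -> l = l'.
  move=> lA l'A Vlp Vl'p; apply/eqP/negPn/negP.
  wlog le_q : l l' lA l'A Vlp Vl'p / (V l q <= V l' q)%N.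
    by move=> H; case: (leqP (V l q) (V l' q)) => [|/ltnW] lq; [|rewrite eq_sym]; exact: H.
  (* Both vectors vanish at [p], [le_q] settles [q], and elsewhere the exponents are at most 1 with
     zeros of [V l'] shared by [V l]. *)
  move=> ll'; have VV : (V l <= V l')%MM.
    apply/mnm_lepP=> j; have [->|jp] := eqVneq j p; first by rewrite Vlp.
    have [->//|jq] := eqVneq j q.
    have := VIII l j lA jp jq; have := same j l' l jp jq l'A lA Vl'p.
    by case: (V l j) => [|[|]] //; case: (V l' j) => // /(_ erefl).
  (* With [V l] as lower bound, (II) for this pair gives [k <= mdeg (V l')], which is impossible. *)
  have := VII [set l; l'] (V l) _ _ _.
  rewrite big_setU1 ?inE //= big_set1 subUset !sub1set lA l'A.
  have /set0Pn -> : exists x, x \in [set l; l'] by exists l; rewrite set21.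
  have := Vk l lA; have := Vk l' l'A => ? ? /(_ isT isT) bound.
  suff : (k - mdeg (V l) + (k - mdeg (V l')) + mdeg (V l) <= k)%N by lia.
  by apply: bound => x; rewrite !inE => /orP[] /eqP->; rewrite ?lepm_refl.
apply: dependent; apply: (@Vindep_shift _ _ _ p) => //; first exact: ratvar_inj.
apply: IHk; last exact: admissible_shift.
by have := Vk i iA; lia.
Qed.

(** * Passage from the listed multiset and [propV] to admissible families *)

(** Each block of the list yields one multiplier. Coefficients are indexed by all of [nat] so that
    the induction can shift them past the first block. *)
Lemma flatten_poly_sum (K : fieldType) (T : eqType) (r : seq T) (d : T -> nat)
  (g : T -> {poly K}) (c : nat -> K) :
  let s := flatten [seq [seq g i * 'X^e | e <- iota 0 (d i)] | i <- r] in
  uniq r -> exists f : T -> {poly K},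
  [/\ forall i, i \in r -> (size (f i) <= d i)%N,
      \sum_(t < size s) c t *: s`_t = \sum_(i <- r) f i * g i
    & (forall i, i \in r -> f i = 0) -> forall t, (t < size s)%N -> c t = 0].
Proof.
elim: r c => [|i r IHr] c /=.
  by exists (fun=> 0); split=> //; rewrite big_nil big_ord0.
set b := [seq _ | e <- _]; set s := flatten _ => /andP[ir r_uniq].
have sb : size b = d i by rewrite size_map size_iota.
have [f [sf fE f0]] := IHr (fun t => c (size b + t)%N) r_uniq.
pose f' j := if j == i then \poly_(e < d i) c e else f j.
have f'r j : j \in r -> f' j = f j.
  by rewrite /f'; case: eqP => // ->; rewrite (negbTE ir).
exists f'; split=> [j||f'0 t].
- rewrite inE => /predU1P[->|jr]; last by rewrite f'r // sf.
  by rewrite /f' eqxx size_poly.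
- rewrite size_cat big_split_ord big_cons /=; congr (_ + _).
    rewrite /f' eqxx poly_def mulr_suml sb; apply: eq_bigr => e _.
    rewrite nth_cat sb ltn_ord (nth_map 0%N) ?size_iota // nth_iota // add0n.
    by rewrite -scalerAl mulrC.
  rewrite (eq_big_seq (fun j => f j * g j)) => [|j /f'r->//]; rewrite -fE.
  by apply: eq_bigr => e _; rewrite nth_cat ltnNge leq_addr /= addKn.
- rewrite size_cat; have [tb _|bt ts] := ltnP t (size b).
    have /(congr1 (coefp t)) := f'0 i (mem_head i r).
    by rewrite /f' eqxx /= coef0 coef_poly -sb tb.
  rewrite -(subnKC bt); apply: f0; last by rewrite ltn_subLR.
  by move=> j jr; rewrite -f'r // f'0 // inE jr orbT.
Qed.

(** [p] and [q] are the last two coordinates, which coincide when [n = 1]; as [l <= 2], every other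
    one is among the first [n - l]. A lower bound of the family lies below [mu], whose entries are
    attained. *)
Lemma admissible_propV (m n l k : nat) (V : 'I_m -> 'X_{1..n}) (p q : 'I_n) :
  (l <= 2)%N -> (1 <= k)%N -> p = n.-1 :> nat -> q = n.-2 :> nat ->
  propV l k V -> admissible p q k [set: 'I_m] V.
Proof.
move=> l2 k1 pn qn [Vk VII VIII].
split=> [i _|I w _ I0 wV|i j _ jp jq]; first by have := Vk i; lia.
- apply: leq_trans (VII I I0); rewrite leq_add2l !mdegE.
  apply: leq_sum => j _; have [i iI ->] := mu_attained V j I0.
  exact: (mnm_lepP (wV i iI)).
- have jnl : (j < n - l)%N.
    move: jp jq; rewrite -!val_eqE /= pn qn; have := ltn_ord j; lia.
  by have := VIII i j jnl; rewrite !inE => /orP[]/eqP->.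
Qed.

Theorem theorem5p7 (F : finFieldType) (k m n l : nat) (V : 'I_m -> 'X_{1..n})
  (hk : (1 <= k)%N) (hm : (1 <= m)%N) (hn : (1 <= n)%N) (hln : (l <= n)%N)
  (hl2 : (l <= 2)%N) (hV : propV l k V) :
  lin_indep (Pfam F k V).
Proof.
have pn : (n.-1 < n)%N by lia.
have qn : (n.-2 < n)%N by lia.
have adm : admissible (Ordinal pn) (Ordinal qn) k [set: 'I_m] V.
  exact: admissible_propV hV.
have ind := Vindep_ratvar (F := F) adm.
(* [c'] extends [c] by 0 beyond the length of the list. *)
move=> c c0 t; pose c' u := oapp c 0 (insub u : option 'I_(size (Pfam F k V))).
have c'E u : c' (val u) = c u by rewrite /c' valK.
have [f [sf fE f0]] := flatten_poly_sum (fun i => k - mdeg (V i))%N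
  (fun i => vprod (@ratvar F n) (V i)) c' (enum_uniq 'I_m).
rewrite -c'E; apply: f0 (ltn_ord t) => i _; apply: ind (in_setT i) => [j _|].
  by apply: sf; rewrite mem_enum.
rewrite (eq_bigl xpredT) => [|j]; last by rewrite inE.
rewrite -big_enum /= -fE -[RHS]c0.
by apply: eq_bigr => u _; rewrite c'E.
Qed.
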